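(* Let $\varepsilon>0$ and $r>\varepsilon$. For every compact family $\mathcal{A}$ of real $n\times n$ matrices with $\max_{A\in\mathcal{A}}\rho(A)\le r$, $$S_{\mathcal{A}}(\varepsilon)\ \ge\ \min_{A\in\mathcal{A}}\frac{2\varepsilon}{M_2(\boldsymbol{h})+2\varepsilon^2},\qquad\text{where }\boldsymbol{h}=-\mathrm{sp}(A)-\varepsilon\boldsymbol{e}.$$
   Context: $\rho(A)$ is the spectral radius of $A$; $\mathrm{sp}(A)\in\mathbb{C}^n$ the vector of eigenvalues with multiplicities; $\boldsymbol{e}=(1,\dots,1)$. The switching system of $\mathcal{A}$ is $\dot{\boldsymbol{x}}=A(t)\boldsymbol{x}$ with $A(\cdot)$ any measurable function $\mathbb{R}_+\to\mathcal{A}$; its Lyapunov exponent $\sigma(\mathcal{A})$ is the infimum of $\alpha$ such that for some $C$ all trajectories satisfy $\|\boldsymbol{x}(t)\|\le Ce^{\alpha t}\|\boldsymbol{x}(0)\|$. The joint spectral radius of a compact set $\mathcal{B}$ is $\rho(\mathcal{B})=\lim_{k}\max_{B(j)\in\mathcal{B}}\|B(k)\cdots B(1)\|^{1/k}$. $S_{\mathcal{A}}(\varepsilon)=+\infty$ if $\sigma(\mathcal{A})\ge-\varepsilon$ and $S_{\mathcal{A}}(\varepsilon)=\sup\{\tau>0:\rho(I+\tau\mathcal{A})<1\}$ otherwise, where $I+\tau\mathcal{A}=\{I+\tau A:A\in\mathcal{A}\}$. For $\boldsymbol{h}\in\mathbb{C}^n$ with $\mathrm{Re}\,h_k>0$,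 $\mathcal{P}_{\boldsymbol{h}}$ is the space of complex linear combinations on $[0,\infty)$ of $e^{-h_kt}$ (a value of multiplicity $r$ contributing $e^{-ht},\dots,t^{r-1}e^{-ht}$), and $M_2(\boldsymbol{h})=\max\{\|p''\|_\infty:p\in\mathcal{P}_{\boldsymbol{h}},\|p\|_\infty\le1\}$ with $\|f\|_\infty=\sup_{t\ge0}|f(t)|$. *)

(* Defs.v *)
From HB Require Import structures.
From mathcomp Require Import all_boot all_order all_algebra.
From mathcomp Require Import all_classical all_reals all_analysis.
From mathcomp Require Import complex.
Set Implicit Arguments. Unset Strict Implicit. Unset Printing Implicit Defensive.
Import Order.TTheory GRing.Theory Num.Theory.
Import numFieldNormedType.Exports.
Local Open Scope classical_set_scope.
Local Open Scope ring_scope.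

Section Defs.
Variable R : realType.
Variable n : nat.

Definition cmod (z : R[i]) : R := Num.sqrt (complex.Re z ^+ 2 + complex.Im z ^+ 2).

Definition toC (A : 'M[R]_n) : 'M[R[i]]_n := map_mx (fun x => Complex x 0) A.

Definition specrad (A : 'M[R]_n) : R :=
  sup [set cmod z | z in [set z : R[i] | eigenvalue (toC A) z]].

Definition cexp (w : R[i]) (t : R) : R[i] :=
  Complex (expR (complex.Re w * t) * cos (complex.Im w * t)) (expR (complex.Re w * t) * sin (complex.Im w * t)).

(* P_h for h = -sp(A) - eps e : complex linear combinations of the functions
   t^j e^{-h_k t} = t^j e^{mu t}, mu = lambda + eps, lambda an eigenvalue of A
   of algebraic multiplicity m, 0 <= j < m.  A triple (mu, j, c) stands for
   the term c t^j e^{mu t}. *)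
Definition inP (A : 'M[R]_n) (eps : R) (p : R -> R[i]) : Prop :=
  exists s : seq (R[i] * nat * R[i]),
    (forall u, u \in s ->
        (u.1.2 < mup (u.1.1 - Complex eps 0%R) (char_poly (toC A)))%N) /\
    forall t : R, p t = \sum_(u <- s) u.2 * (Complex t 0) ^+ u.1.2 * cexp u.1.1 t.

Definition supnorm (f : R -> R[i]) : \bar R :=
  ereal_sup [set (cmod (f t))%:E | t in [set t : R | 0 <= t]].

Definition d2 (p : R -> R[i]) : R -> R[i] := fun t =>
  Complex (derive1 (derive1 (fun s => complex.Re (p s))) t)
          (derive1 (derive1 (fun s => complex.Im (p s))) t).

Definition M2 (A : 'M[R]_n) (eps : R) : \bar R :=
  ereal_sup [set supnorm (d2 p) | p in [set p | inP A eps p /\ (supnorm p <= 1)%E]].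

Definition switching (calA : set 'M[R]_n) (Af : R -> 'M[R]_n) : Prop :=
  (forall t, 0 <= t -> calA (Af t)) /\
  forall i j, measurable_fun [set t : R | 0 <= t] (fun t => Af t i j).

Definition trajectory (Af : R -> 'M[R]_n) (x : R -> 'cV[R]_n) : Prop :=
  forall t, 0 <= t -> forall i : 'I_n,
    (@lebesgue_measure R).-integrable `[0, t]
        (EFin \o (fun s => (Af s *m x s) i ord0)) /\
    x t i ord0 = x 0 i ord0 +
       Rintegral (@lebesgue_measure R) `[0, t] (fun s => (Af s *m x s) i ord0).

Definition lyap (calA : set 'M[R]_n) : \bar R :=
  ereal_inf [set a%:E | a in [set a : R | exists C : R,
     forall Af x, switching calA Af -> trajectory Af x ->
       forall t, 0 <= t -> `|x t| <= C * expR (a * t) * `|x 0| ]].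

Definition jsr (B : set 'M[R]_n) : R :=
  limn (fun k : nat =>
    (sup [set `|\prod_(i < k) f i| |
           f in [set f : 'I_k -> 'M[R]_n | forall i, B (f i)]]) `^ (k%:R^-1)).

Definition Sfun (calA : set 'M[R]_n) (eps : R) : \bar R :=
  if ((- eps)%:E <= lyap calA)%E then +oo%E
  else ereal_sup [set tau%:E | tau in [set tau : R |
          0 < tau /\ jsr [set 1%:M + tau *: A | A in calA] < 1]].

End Defs.

(* Main.v *)
(* If the Lyapunov exponent is below [- eps], the functionals
   [e_i exp(t_1 (A_1 + eps)) ... exp(t_k (A_k + eps))], with [A_j] in the family
   and [t_j >= 0], are uniformly bounded, so their supremum is a norm for which
   every [exp(t (A + eps))] is a contraction.  For such a functional [l], the
   function [g t = l exp(t (A + eps)) x] lies in [P_h] and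
   [l (1 + tau A) x = (1 - tau eps) (g 0 + s g' 0)] for
   [s = tau / (1 - tau eps)].  By Taylor's formula this is at most
   [(1 - tau eps) (1 + s^2 M_2 / 2)] times the norm of [x], and that factor is
   below 1 iff [tau (M_2 + 2 eps^2) < 2 eps].  Hence the norm contracts under
   all [1 + tau A], uniformly over the family. *)
Require Import Defs.
From HB Require Import structures.
From mathcomp Require Import all_boot all_order all_algebra.
From mathcomp Require Import all_classical all_reals all_analysis.
From mathcomp Require Import complex.
From mathcomp Require Import measurable_realfun.
From mathcomp Require Import ring lra.
Import Order.TTheory GRing.Theory Num.Theory.
Import numFieldNormedType.Exports.
Local Open Scope classical_set_scope.
Local Open Scope ring_scope.

Set Implicit Arguments.
Unset Strict Implicit.

(** * Real and complex derivatives *)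

Section RealDerivatives.
Variable R : realType.
Implicit Types (f g : R -> R) (t a b : R).

Lemma is_derive_add f g t a b : is_derive t 1 f a -> is_derive t 1 g b ->
  is_derive t 1 (fun s => f s + g s) (a + b).
Proof. by move=> fa gb; exact: (is_deriveD fa gb). Qed.

Lemma is_derive_mul f g t a b : is_derive t 1 f a -> is_derive t 1 g b ->
  is_derive t 1 (fun s => f s * g s) (a * g t + f t * b).
Proof.
move=> fa gb; have fg := is_deriveM fa gb; apply: (is_derive_eq fg).
by rewrite addrC /GRing.scale /= [g t * a]mulrC.
Qed.

Lemma is_derive_bigsum (I : Type) (r : seq I) (f : I -> R -> R) (a : I -> R) t :
  (forall i, is_derive t 1 (f i) (a i)) ->
  is_derive t 1 (fun s => \sum_(i <- r) f i s) (\sum_(i <- r) a i).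
Proof.
move=> fa; elim: r => [|i r IH].
  by under eq_fun do rewrite big_nil; rewrite big_nil; exact: is_derive_cst.
under eq_fun do rewrite big_cons.
by rewrite big_cons; exact: is_derive_add.
Qed.

Lemma is_derive_derive1 f (df : R -> R) : (forall t, is_derive t 1 f (df t)) ->
  derive1 f = df.
Proof. by move=> fd; apply/funext => t; rewrite derive1E derive_val. Qed.

Lemma derivable_continuous (f df : R -> R) :
  (forall t : R, is_derive t 1 f (df t)) -> continuous f.
Proof.
move=> fd x.
by apply: differentiable_continuous; apply/derivable1_diffP; case: (fd x).
Qed.

Lemma is_derive_shiftN f t T a : is_derive (t - T) 1 f a ->
  is_derive t 1 (fun s => f (s - T)) a.
Proof.
move=> fa; rewrite -[a]mulr1.
apply: (@is_derive1_comp _ f (fun s => s - T) t a 1) => //.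
by rewrite -[X in is_derive _ _ _ X]addr0; apply: is_derive_add.
Qed.

Lemma is_derive_expRM (c t : R) :
  is_derive t 1 (fun s => expR (c * s)) (c * expR (c * t)).
Proof.
rewrite mulrC; apply: (@is_derive1_comp _ expR (fun s => c * s) t).
by apply: is_derive_eq; rewrite /GRing.scale /= mulr1.
Qed.

(** The mean value theorem is used twice: first on [g1], giving [g1 t - g1 0 >= - K * t], then on
    [phi], the difference of the two sides up to a constant, whose derivative is thereby
    nonnegative. No regularity of [g2] enters, only its lower bound. *)
Lemma taylor2_upper (g g1 g2 : R -> R) (K s : R) : 0 <= s ->
  (forall t, is_derive t 1 g (g1 t)) -> (forall t, is_derive t 1 g1 (g2 t)) ->
  (forall t, 0 <= t -> - K <= g2 t) ->
  g 0 + s * g1 0 <= g s + K * s ^+ 2 / 2.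
Proof.
move=> s0 gd g1d g2K.
have cont (f df : R -> R) (a b : R) : (forall t : R, is_derive t 1 f (df t)) ->
    {within `[a, b], continuous f}.
  by move=> fd; apply: continuous_subspaceT; exact: derivable_continuous fd.
have g1K t : 0 <= t -> - K * t <= g1 t - g1 0.
  move=> t0; have [c /itvP c_in ->] := @MVT_segment _ g1 g2 _ _ t0
    (fun x _ => g1d x) (cont _ _ _ _ g1d).
  by rewrite subr0 ler_wpM2r // g2K ?c_in.
pose phi t := g t + (- g1 0 * t + K / 2 * (t * t)).
pose dphi t := g1 t + (- g1 0 + K * t).
have phid t : is_derive t 1 phi (dphi t).
  have D1 : is_derive t 1 (fun t => - g1 0 * t) (- g1 0).
    by apply: is_derive_eq; rewrite /GRing.scale /= mulr1.
  have D2 : is_derive t 1 (fun t => K / 2 * (t * t)) (K * t).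
    have D3 := is_derive_mul (is_derive_id t (1 : R)) (is_derive_id t (1 : R)).
    have D4 := is_derive_mul (is_derive_cst (K / 2) t (1 : R)) D3.
    by apply: (is_derive_eq D4) => /=; field.
  exact: (is_derive_add (gd t) (is_derive_add D1 D2)).
have [c /itvP c_in] := @MVT_segment _ phi dphi _ _ s0
    (fun x _ => phid x) (cont _ _ _ _ phid).
have : 0 <= dphi c * (s - 0).
  by apply: mulr_ge0; [have := g1K c; rewrite c_in /dphi => /(_ isT); lra | lra].
move=> h e; move: h; rewrite -e /phi; lra.
Qed.

End RealDerivatives.

Section ComplexCalculus.
Variable R : realType.
Local Notation C := R[i].
Implicit Types (F G : R -> C) (t : R) (a b w : C).

(* Componentwise, as the library has no derivative for maps from [R] to [R[i]]. *)
Definition cderiv F t a := is_derive t 1 (fun s => complex.Re (F s)) (complex.Re a)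
  /\ is_derive t 1 (fun s => complex.Im (F s)) (complex.Im a).

Lemma cderiv_cst a t : cderiv (fun=> a) t 0.
Proof. by split; exact: is_derive_cst. Qed.

Lemma Re_add a b : complex.Re (a + b) = complex.Re a + complex.Re b.
Proof. by case: a b => [a1 a2] [b1 b2]. Qed.

Lemma Im_add a b : complex.Im (a + b) = complex.Im a + complex.Im b.
Proof. by case: a b => [a1 a2] [b1 b2]. Qed.

Lemma cderivD F G t a b : cderiv F t a -> cderiv G t b ->
  cderiv (fun s => F s + G s) t (a + b).
Proof.
case=> Fr Fi [Gr Gi]; split.
  by under eq_fun do rewrite Re_add; rewrite Re_add; exact: is_derive_add.
by under eq_fun do rewrite Im_add; rewrite Im_add; exact: is_derive_add.
Qed.

Lemma Re_mul a b :
  complex.Re (a * b) = complex.Re a * complex.Re b - complex.Im a * complex.Im b.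
Proof. by case: a b => [a1 a2] [b1 b2]. Qed.

Lemma Im_mul a b :
  complex.Im (a * b) = complex.Re a * complex.Im b + complex.Im a * complex.Re b.
Proof. by case: a b => [a1 a2] [b1 b2]. Qed.

Lemma cderivM F G t a b : cderiv F t a -> cderiv G t b ->
  cderiv (fun s => F s * G s) t (a * G t + F t * b).
Proof.
case=> Fr Fi [Gr Gi]; split.
  under eq_fun do rewrite Re_mul.
  have D := is_derive_add (is_derive_mul Fr Gr) (is_deriveN (is_derive_mul Fi Gi)).
  by apply: (is_derive_eq D); rewrite Re_add !Re_mul; ring.
under eq_fun do rewrite Im_mul.
have D := is_derive_add (is_derive_mul Fr Gi) (is_derive_mul Fi Gr).
by apply: (is_derive_eq D); rewrite Im_add !Im_mul; ring.
Qed.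

Lemma cderiv_sum (I : eqType) (r : seq I) (F : I -> R -> C) (a : I -> C) t :
  (forall i, i \in r -> cderiv (F i) t (a i)) ->
  cderiv (fun s => \sum_(i <- r) F i s) t (\sum_(i <- r) a i).
Proof.
elim: r => [|i r IH] Fa.
  by under eq_fun do rewrite big_nil; rewrite big_nil; exact: cderiv_cst.
under eq_fun do rewrite big_cons.
rewrite big_cons; apply: cderivD; first by apply: Fa; rewrite mem_head.
by apply: IH => j jr; apply: Fa; rewrite inE jr orbT.
Qed.

Lemma cderiv_eq F t a b : cderiv F t a -> a = b -> cderiv F t b.
Proof. by move=> ? <-. Qed.

Lemma cderivMl F t a b : cderiv F t a -> cderiv (fun s => b * F s) t (b * a).
Proof.
move=> Fa; apply: (cderiv_eq (cderivM (cderiv_cst b t) Fa)).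
by rewrite mul0r add0r.
Qed.

Lemma cderiv_id t : cderiv (fun s => Complex s 0) t 1.
Proof. by split; [exact: is_derive_id|exact: is_derive_cst]. Qed.

Lemma cderivX n t :
  cderiv (fun s => Complex s 0 ^+ n.+1) t (n.+1%:R * Complex t 0 ^+ n).
Proof.
elim: n => [|n IH]; first by rewrite mulr1; exact: cderiv_id.
under eq_fun do rewrite exprS.
apply: cderiv_eq; first exact: (cderivM (cderiv_id t) IH).
by rewrite -[in RHS]natr1 mul1r exprS; ring.
Qed.

Lemma cderiv_cexp w t : cderiv (cexp w) t (w * cexp w t).
Proof.
case: w => u v; rewrite /cexp /=.
have Dv : is_derive t 1 (fun s => v * s) v.
  by apply: is_derive_eq; rewrite /GRing.scale /= mulr1.
have Dc : is_derive t 1 (fun s => cos (v * s)) (- sin (v * t) * v).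
  exact: (@is_derive1_comp _ cos (fun s => v * s)).
have Ds : is_derive t 1 (fun s => sin (v * s)) (cos (v * t) * v).
  exact: (@is_derive1_comp _ sin (fun s => v * s)).
split.
  by apply: (is_derive_eq (is_derive_mul (is_derive_expRM u t) Dc)) => /=; ring.
by apply: (is_derive_eq (is_derive_mul (is_derive_expRM u t) Ds)) => /=; ring.
Qed.

Lemma cexp0 w : cexp w 0 = 1.
Proof. by rewrite /cexp !mulr0 expR0 cos0 sin0 mulr1 mulr0. Qed.

Lemma cexpD v w t : cexp (v + w) t = cexp v t * cexp w t.
Proof.
case: v w => [v1 v2] [w1 w2]; rewrite /cexp /= !mulrDl expRD cosD sinD.
by congr Complex; ring.
Qed.

End ComplexCalculus.

(** * Explicit matrix exponential *)

Section PrimaryDecomposition.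
Variables (F : fieldType) (n : nat) (M : 'M[F]_n.+1).

Lemma horner_mx_XsubCX a k :
  horner_mx M (('X - a%:P) ^+ k) = (M - a%:M) ^+ k.
Proof. by rewrite rmorphXn rmorphB /= horner_mx_X horner_mx_C. Qed.

(** Induction on the roots: the factor of [a] is coprime to the product of the others, and a Bezout
    identity splits [V] into a part killed by that factor and a part killed by the rest. With [V]
    the identity, this decomposes the whole space into generalized eigenspaces. *)
Lemma primary_decomposition (s : seq F) (m : F -> nat) (V : 'M[F]_n.+1) :
  uniq s -> horner_mx M (\prod_(a <- s) ('X - a%:P) ^+ m a) * V = 0 ->
  exists2 W : F -> 'M[F]_n.+1, V = \sum_(a <- s) W a &
    forall a, a \in s -> (M - a%:M) ^+ m a * W a = 0.
Proof.
elim: s V => [|a s IH] V.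
  rewrite big_nil rmorph1 mul1r => _ V0.
  by exists (fun=> 0) => //; rewrite big_nil.
case/andP=> a_s uniq_s; rewrite big_cons.
set p := ('X - a%:P) ^+ m a; set q := \prod_(b <- s) _ => pqV.
have cop : coprimep p q.
  rewrite /q big_seq; elim/big_ind: _ => [|f g cf cg|b b_s].
  - exact: coprimep1.
  - by rewrite coprimepMr cf.
  apply/coprimep_expl/coprimep_expr; rewrite coprimep_XsubC root_XsubC.
  by apply: contraNneq a_s => <-.
have [[u v] /= uv1] := Bezout_eq1_coprimepP _ _ cop.
pose V1 := horner_mx M (v * q) * V; pose V2 := horner_mx M (u * p) * V.
have hV1 : (M - a%:M) ^+ m a * V1 = 0.
  rewrite -horner_mx_XsubCX mulrA -rmorphM.
  have -> : ('X - a%:P) ^+ m a * (v * q) = v * (p * q) by rewrite /p; ring.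
  by rewrite rmorphM -mulrA pqV mulr0.
have hV2 : horner_mx M q * V2 = 0.
  rewrite mulrA -rmorphM.
  have -> : q * (u * p) = u * (p * q) by ring.
  by rewrite rmorphM -mulrA pqV mulr0.
have [W VW hW] := IH V2 uniq_s hV2.
exists (fun b => if b == a then V1 else W b).
  rewrite big_cons eqxx big_seq.
  under eq_bigr => b b_s.
    rewrite (negbTE (_ : b != a)); last by apply: contraNneq a_s => <-.
    over.
  by rewrite -big_seq -VW /V1 /V2 -mulrDl -rmorphD addrC uv1 rmorph1 mul1r.
move=> b; rewrite inE; case: eqP => [-> _ //|_ /= b_s]; exact: hW.
Qed.

End PrimaryDecomposition.

Lemma char_poly_prod (F : closedFieldType) n (M : 'M[F]_n) :
  exists2 s : seq F, uniq s &
    char_poly M = \prod_(a <- s) ('X - a%:P) ^+ mup a (char_poly M).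
Proof.
have [r] := closed_field_poly_normal (char_poly M).
rewrite (monicP (char_poly_monic M)) scale1r => Mr.
exists (undup r); first exact: undup_uniq.
rewrite [LHS]Mr -big_undup_iterop_count; apply: eq_bigr => a _.
by rewrite Mr mu_prod_XsubC.
Qed.

Section ExpPoly.
Variable R : realType.
Local Notation C := R[i].
Implicit Types (P : {poly C}) (f g : R -> C).

(** For [P] the characteristic polynomial of [toC A], this is the space [inP A eps] before the
    exponents are shifted by [eps]; multiplication by the exponential of [eps * t] passes from one
    to the other. *)
Definition exp_poly P f : Prop :=
  exists s : seq (C * nat * C),
    (forall u, u \in s -> (u.1.2 < mup u.1.1 P)%N) /\
    forall t, f t = \sum_(u <- s) u.2 * Complex t 0 ^+ u.1.2 * cexp u.1.1 t.

Lemma exp_poly0 P : exp_poly P (fun=> 0).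
Proof. by exists [::]; split=> // t; rewrite big_nil. Qed.

Lemma exp_polyD P f g : exp_poly P f -> exp_poly P g ->
  exp_poly P (fun t => f t + g t).
Proof.
move=> [s [hs fs]] [s' [hs' gs]]; exists (s ++ s'); split.
  by move=> u; rewrite mem_cat => /orP[/hs|/hs'].
by move=> t; rewrite big_cat fs gs.
Qed.

Lemma exp_polyMl P c f : exp_poly P f -> exp_poly P (fun t => c * f t).
Proof.
move=> [s [hs fs]]; exists [seq (u.1, c * u.2) | u <- s]; split.
  by move=> u /mapP[v /hs ? ->].
by move=> t; rewrite big_map fs mulr_sumr; apply: eq_bigr => u _; rewrite !mulrA.
Qed.

Lemma exp_poly_sum P (I : eqType) (r : seq I) (f : I -> R -> C) :
  (forall i, i \in r -> exp_poly P (f i)) ->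
  exp_poly P (fun t => \sum_(i <- r) f i t).
Proof.
elim: r => [|i r IH] hf.
  by under eq_fun do rewrite big_nil; exact: exp_poly0.
under eq_fun do rewrite big_cons.
apply: exp_polyD; first by apply: hf; rewrite mem_head.
by apply: IH => j jr; apply: hf; rewrite inE jr orbT.
Qed.

Lemma exp_poly_term P c k w : (k < mup w P)%N ->
  exp_poly P (fun t => c * (Complex t 0 ^+ k * cexp w t)).
Proof.
move=> hk; exists [:: ((w, k), c)]; split.
  by move=> u; rewrite inE => /eqP ->.
by move=> t; rewrite big_seq1 mulrA.
Qed.

Lemma inP_exp_poly n (A : 'M[R]_n) eps f : exp_poly (char_poly (toC A)) f ->
  inP A eps (fun t => cexp (Complex eps 0) t * f t).
Proof.
move=> [s [hs fs]]; exists [seq (u.1.1 + Complex eps 0, u.1.2, u.2) | u <- s].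
split=> [u /mapP[v /hs ? ->] /=|t]; first by rewrite addrK.
rewrite big_map fs mulr_sumr; apply: eq_bigr => u _ /=.
by rewrite cexpD; ring.
Qed.

End ExpPoly.

Section ComplexSolution.
Variable R : realType.
Local Notation C := R[i].

(** Dividing by the factorial makes differentiation send index [k.+1] to [a] times itself plus index
    [k], with no further coefficient, as along a Jordan chain. *)
Definition expmon (a : C) (k : nat) (t : R) : C :=
  k`!%:R^-1 * (Complex t 0 ^+ k * cexp a t).

Lemma cderiv_expmon0 a t : cderiv (expmon a 0) t (a * expmon a 0 t).
Proof.
rewrite /expmon; apply: (@cderiv_eq _ _ _ (1^-1 * (a * cexp a t))).
  apply: cderivMl; under eq_fun do rewrite expr0 mul1r.
  exact: cderiv_cexp.
by rewrite expr0 mul1r fact0 invr1 !mul1r.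
Qed.

Lemma cderiv_expmonS a k t :
  cderiv (expmon a k.+1) t (a * expmon a k.+1 t + expmon a k t).
Proof.
rewrite /expmon.
apply: (cderiv_eq (cderivMl _ (cderivM (cderivX k t) (cderiv_cexp a t)))).
rewrite factS natrM.
have k0 : k`!%:R != 0 :> C by rewrite pnatr_eq0 -lt0n fact_gt0.
have k1 : k.+1%:R != 0 :> C by rewrite pnatr_eq0.
by field; rewrite k0 /= addrC natr1.
Qed.

Lemma expmon_at0 a k : expmon a k 0 = (k == 0%N)%:R.
Proof.
rewrite /expmon cexp0 mulr1 (_ : Complex 0 0 = 0 :> C) // expr0n.
by case: k => [|k]; rewrite ?mulr0 // invr1 mulr1.
Qed.

(** [U t] is $e^{at} e^{tN} W$ with [N] equal to [M - a%:M]; the exponential series in [N] stops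
    because [N ^+ m] kills [W]. *)
Lemma generalized_eigen_solution n (M W : 'M[C]_n.+1) (a : C) m :
  (M - a%:M) ^+ m * W = 0 ->
  let U t := \sum_(k < m) expmon a k t *: ((M - a%:M) ^+ k * W) in
  U 0 = W /\ forall t i j, cderiv (fun s => U s i j) t ((M * U t) i j).
Proof.
set N := M - a%:M => NW U; split.
  rewrite /U; case: m NW {U} => [|m] NW.
    by rewrite big_ord0 -NW mul1r.
  rewrite big_ord_recl expmon_at0 scale1r mul1r big1 ?addr0 // => k _.
  by rewrite expmon_at0 scale0r.
move=> t i j.
pose d k := if k is k'.+1 then a * expmon a k'.+1 t + expmon a k' t
  else a * expmon a 0 t.
have dP k : cderiv (expmon a k) t (d k).
  by case: k => [|k]; [exact: cderiv_expmon0|exact: cderiv_expmonS].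
have -> : (M * U t) i j = \sum_(k < m) d k * (N ^+ k * W) i j.
  have -> : M * U t = \sum_(k < m) d k *: (N ^+ k * W).
    have -> : M = a%:M + N by rewrite /N addrC subrK.
    rewrite mulrDl -mulmxE mul_scalar_mx mulmxE /U scaler_sumr mulr_sumr.
    under [X in _ + X]eq_bigr do rewrite -scalerAr mulrA -exprS.
    (* For [m = 0] all sums are empty. Otherwise the top term of the sum shifted by [N] vanishes,
       and its remaining terms pair with those of index at least 1 in the first sum. *)
    case: m NW {U} => [|m] NW; first by rewrite !big_ord0 addr0.
    rewrite [X in _ + X]big_ord_recr /= NW scaler0 addr0.
    rewrite !big_ord_recl /= scalerA -addrA -big_split /=; congr (_ + _).
    by apply: eq_bigr => k _; rewrite scalerA -scalerDl.
  by rewrite summxE; apply: eq_bigr => k _; rewrite mxE.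
under eq_fun => s.
  rewrite summxE.
  under eq_bigr do rewrite mxE mulrC.
  over.
under [X in cderiv _ _ X]eq_bigr do rewrite mulrC.
by apply: cderiv_sum => k _; apply: cderivMl.
Qed.

(** By Cayley-Hamilton the identity itself is killed by the characteristic polynomial. Splitting it
    by primary decomposition and solving on each piece gives the exponential of [t M] with entries
    that are visibly exponential polynomials. *)
Lemma matrix_solution n (M : 'M[C]_n) : exists U : R -> 'M[C]_n,
  [/\ U 0 = 1%:M,
      forall t i j, cderiv (fun s => U s i j) t ((M *m U t) i j) &
      forall i j, exp_poly (char_poly M) (fun t => U t i j)].
Proof.
case: n M => [|n] M.
  by exists (fun=> 1%:M); split=> // ? [].
have [s us Ms] := char_poly_prod M.
have [|W sumW hW] := @primary_decomposition _ _ M s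
  (fun a => mup a (char_poly M)) 1 us; first by rewrite -Ms Cayley_Hamilton mul0r.
pose U a t := \sum_(k < mup a (char_poly M))
  expmon a k t *: ((M - a%:M) ^+ k * W a).
have hU a (a_s : a \in s) := generalized_eigen_solution (hW a a_s).
exists (fun t => \sum_(a <- s) U a t); split.
- rewrite (_ : 1%:M = 1) // sumW !big_seq; apply: eq_bigr => a a_s.
  by have [] := hU a a_s.
- move=> t i j; rewrite mulmx_sumr summxE; under eq_fun do rewrite summxE.
  by apply: cderiv_sum => a a_s; have [_] := hU a a_s; exact.
- move=> i j; under eq_fun do rewrite summxE.
  apply: exp_poly_sum => a _; under eq_fun do rewrite summxE.
  apply: exp_poly_sum => k _; under eq_fun do rewrite mxE mulrC mulrA.
  exact: exp_poly_term.
Qed.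

End ComplexSolution.

(** * Trajectories of the switching system *)

Section Trajectories.
Variable R : realType.
Local Notation mu := (@lebesgue_measure R).

Lemma integrable_setU_disjoint d (T : measurableType d)
    (nu : {measure set T -> \bar R}) (A B : set T) (f : T -> \bar R) :
  measurable A -> measurable B -> [disjoint A & B] ->
  nu.-integrable A f -> nu.-integrable B f -> nu.-integrable (A `|` B) f.
Proof.
move=> mA mB AB /integrableP[mfA fA] /integrableP[mfB fB].
apply/integrableP; split; first by rewrite measurable_funU.
rewrite ge0_integral_setU //; first exact: lte_add_pinfty.
by apply: measurableT_comp => //; rewrite measurable_funU.
Qed.

Lemma FTC_segment (F f : R -> R) a b : a <= b ->
  (forall t : R, is_derive t 1 F (f t)) -> continuous f ->
  mu.-integrable `[a, b] (EFin \o f) /\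
  \int[mu]_(x in `[a, b]) f x = F b - F a.
Proof.
move=> ab Fd cf.
have cw : {within `[a, b], continuous f} by exact: continuous_subspaceT.
split; first by apply: continuous_compact_integrable => //; exact: segment_compact.
(* The degenerate interval is treated apart, since [continuous_FTC2] is applied with [a < b]. *)
move: ab; rewrite le_eqVlt => /predU1P[ab|ab].
  by rewrite /Rintegral -ab set_itv1 integral_set1 subrr.
have cF := derivable_continuous Fd.
rewrite /Rintegral (continuous_FTC2 ab cw (F := F)) //.
- split=> [x _||]; first by case: (Fd x).
  + exact/cvg_at_right_filter/cF.
  + exact/cvg_at_left_filter/cF.
- by move=> x _; rewrite (is_derive_derive1 Fd).
Qed.

Variable n : nat.
Implicit Types (A : 'M[R]_n) (y : R -> 'cV[R]_n) (calA : set 'M[R]_n).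

(** The equation is imposed at every real time, so that time shifts preserve it and derivatives are
    two-sided at 0 as well. *)
Definition linear_ode A y :=
  forall (t : R) i, is_derive t 1 (fun s => y s i ord0) ((A *m y t) i ord0).

Lemma linear_ode_mul A y k (D : 'M[R]_(k, n)) (t : R) i : linear_ode A y ->
  is_derive t 1 (fun s => (D *m y s) i ord0) ((D *m (A *m y t)) i ord0).
Proof.
move=> yA; rewrite mxE; under eq_fun do rewrite mxE.
apply: is_derive_bigsum => j.
have D1 := is_derive_mul (is_derive_cst (D i j) t (1 : R)) (yA t j).
by apply: (is_derive_eq D1); rewrite mul0r add0r.
Qed.

Lemma linear_ode_int A y a b i : a <= b -> linear_ode A y ->
  mu.-integrable `[a, b] (EFin \o (fun s => (A *m y s) i ord0)) /\
  \int[mu]_(s in `[a, b]) (A *m y s) i ord0 = y b i ord0 - y a i ord0.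
Proof.
move=> ab yA; apply: (FTC_segment (F := fun s => y s i ord0)) => // t.
have cAy := derivable_continuous (fun t => linear_ode_mul A t i yA).
exact: cAy.
Qed.

Lemma linear_ode_shift A y T : linear_ode A y ->
  linear_ode A (fun s => y (s - T)).
Proof. by move=> yA t i; apply: (is_derive_shiftN (yA (t - T) i)). Qed.

Lemma linear_ode_trajectory A y : linear_ode A y -> trajectory (fun=> A) y.
Proof.
move=> yA t t0 i; have [? ->] := linear_ode_int i t0 yA.
by split=> //; rewrite addrC subrK.
Qed.

Lemma switching_cst calA A : calA A -> switching calA (fun=> A).
Proof. by move=> cA; split=> // i j; exact: measurable_cst. Qed.

Lemma switching_append calA Af A T : switching calA Af -> calA A ->
  switching calA (fun s => if s <= T then Af s else A).
Proof.
move=> [cAf mAf] cA; split=> [t t0|i j]; first by case: ifP => // _; exact: cAf.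
rewrite (_ : (fun _ => _) = fun t => if t <= T then Af t i j else A i j);
  last by apply/funext => t; case: ifP.
have m0 : measurable [set t : R | 0 <= t].
  by rewrite -set_itvcy; exact: measurable_itv.
apply: measurable_fun_if => //.
- by apply: measurable_fun_ler => //; exact: measurable_cst.
- apply: measurable_funS (mAf i j) => //; exact: subIsetl.
Qed.

(** The integral over [[0, t]] splits at [T]; the second piece equals [y (t - T) - y 0] and
    telescopes with [x T]. *)
Lemma trajectory_append Af x A y T : 0 <= T -> trajectory Af x ->
  linear_ode A y -> y 0 = x T ->
  trajectory (fun s => if s <= T then Af s else A)
             (fun s => if s <= T then x s else y (s - T)).
Proof.
move=> T0 xAf yA y0 t t0 i; rewrite T0.
set h := fun s : R => ((if s <= T then Af s else A) *m
  (if s <= T then x s else y (s - T))) i ord0.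
have hx a b : b <= T -> {in `[a, b], (fun s => (Af s *m x s) i ord0) =1 h}.
  move=> bT s /itvP s_in; rewrite /h.
  by rewrite (le_trans _ bT) // s_in.
case: (leP t T) => tT.
  have [int_x ->] := xAf t t0 i; split.
    apply: eq_integrable int_x => // s /set_mem sin.
    by rewrite /= (hx 0 t tT).
  by congr (_ + _); apply: eq_Rintegral => s /set_mem sin; rewrite (hx 0 t tT).
have [int_x x_T] := xAf T T0 i.
have [int_y y_t] := linear_ode_int i (ltW tT) (linear_ode_shift T yA).
(* At time [T] the old law still applies, so the new integrand matches that of [y] on the half-open
   interval only. The missing point is null and is put back before the integral is evaluated. *)
have hy : {in `]T, t], (fun s => (A *m y (s - T)) i ord0) =1 h}.
  by move=> s /itvP s_in; rewrite /h leNgt s_in.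
have int1 : mu.-integrable `[0, T] (EFin \o h).
  apply: eq_integrable int_x => // s /set_mem sin.
  by rewrite /= (hx 0 T (lexx T)).
have int_y' : mu.-integrable `]T, t]
    (EFin \o (fun s => (A *m y (s - T)) i ord0)).
  apply: integrableS int_y => //; exact: subset_itv_oc_cc.
have int2 : mu.-integrable `]T, t] (EFin \o h).
  apply: eq_integrable int_y' => // s /set_mem sin.
  by rewrite /= hy.
have E : [set` `[0, t]] = `[0, T]%classic `|` `]T, t]%classic.
  by rewrite -itv_bndbnd_setU // bnd_simp // ltW.
have dis : [disjoint `[0, T]%classic & `]T, t]%classic].
  apply/disj_setPS => s []; rewrite /= !in_itv /=.
  by move=> /andP[_ sT] /andP[Ts _]; rewrite leNgt Ts in sT.
have int12 : mu.-integrable (`[0, T] `|` `]T, t]) (EFin \o h).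
  by apply: integrable_setU_disjoint.
rewrite E; split=> //; rewrite Rintegral_setU //.
rewrite -(@eq_Rintegral _ _ _ mu `[0, T] h (fun s => (Af s *m x s) i ord0)); last first.
  by move=> s /set_mem sin; rewrite (hx 0 T (lexx T)).
rewrite -(@eq_Rintegral _ _ _ mu `]T, t] h (fun s => (A *m y (s - T)) i ord0)); last first.
  by move=> s /set_mem sin; rewrite hy.
rewrite Rintegral_itv_obnd_cbnd // y_t subrr y0 x_T; ring.
Qed.

End Trajectories.

(** * The maximum norm of matrices *)

Section MatrixNorm.
Variable R : realType.

Lemma entry_le_norm m n (M : 'M[R]_(m, n)) i j : `|M i j| <= `|M|.
Proof.
rewrite [`|M|]mx_normrE.
by rewrite (le_trans _ (@Order.TotalTheory.le_bigmax _ _ _ _ _ (i, j))).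
Qed.

Lemma norm_le_entries m n (M : 'M[R]_(m, n)) c : 0 <= c ->
  (forall i j, `|M i j| <= c) -> `|M| <= c.
Proof.
by move=> c0 Mc; rewrite [`|M|]mx_normrE; apply/bigmax_leP; split.
Qed.

(** The norm is the largest absolute value of an entry; an entry of the product is a sum of [n]
    terms, whence the factor [n]. *)
Lemma norm_mulmx_le m n k (M : 'M[R]_(m, n)) (N : 'M[R]_(n, k)) :
  `|M *m N| <= n%:R * `|M| * `|N|.
Proof.
apply: norm_le_entries => [|i j]; first by rewrite !mulr_ge0.
rewrite mxE (le_trans (ler_norm_sum _ _ _)) //.
rewrite (@le_trans _ _ (\sum_(l < n) `|M| * `|N|)) //.
  by apply: ler_sum => l _; rewrite normrM ler_pM // entry_le_norm.
by rewrite sumr_const card_ord -mulrA mulr_natl.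
Qed.

End MatrixNorm.

(** * The extremal norm and one Euler step *)

Section FundamentalSolutions.
Variables (R : realType) (n : nat).
Implicit Types (A : 'M[R]_n) (E Y : R -> 'M[R]_n) (l : 'rV[R]_n).
Implicit Types (calA : set 'M[R]_n).

Definition matrix_ode A E :=
  forall (t : R) i j, is_derive t 1 (fun s => E s i j) ((A *m E t) i j).

Lemma matrix_ode_linear A E (x : 'cV[R]_n) : matrix_ode A E ->
  linear_ode A (fun t => E t *m x).
Proof.
move=> EA t i; rewrite mulmxA mxE; under eq_fun do rewrite mxE.
apply: is_derive_bigsum => j.
have D1 := is_derive_mul (EA t i j) (is_derive_cst (x j ord0) t (1 : R)).
by apply: (is_derive_eq D1); rewrite mulr0 addr0.
Qed.

Lemma Re_toC_mul A (U : 'M[R[i]]_n) i j :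
  complex.Re ((toC A *m U) i j) = (A *m map_mx (@complex.Re R) U) i j.
Proof.
rewrite !mxE (big_morph (@complex.Re R) (@Re_add R) (erefl : complex.Re 0 = 0)).
by apply: eq_bigr => k _; rewrite !mxE Re_mul mul0r subr0.
Qed.

Lemma Im_toC_mul A (U : 'M[R[i]]_n) i j :
  complex.Im ((toC A *m U) i j) = (A *m map_mx (@complex.Im R) U) i j.
Proof.
rewrite !mxE (big_morph (@complex.Im R) (@Im_add R) (erefl : complex.Im 0 = 0)).
by apply: eq_bigr => k _; rewrite !mxE Im_mul mul0r addr0.
Qed.

(** Since [toC A] is real, both parts of the complex solution satisfy the real equation. The
    imaginary part [Y] is kept because the exponential polynomial obtained here is the combination
    of [E] and [Y]. *)
Lemma real_matrix_solution A : exists E Y : R -> 'M[R]_n,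
  [/\ E 0 = 1%:M, Y 0 = 0, matrix_ode A E, matrix_ode A Y &
      forall i j, exp_poly (char_poly (toC A)) (fun t => Complex (E t i j) (Y t i j))].
Proof.
have [U [U0 UA Uexp]] := matrix_solution (toC A).
exists (fun t => map_mx (@complex.Re R) (U t)), (fun t => map_mx (@complex.Im R) (U t)).
split.
- by rewrite U0; apply/matrixP => i j; rewrite !mxE; case: eqP.
- by rewrite U0; apply/matrixP => i j; rewrite !mxE; case: eqP.
- move=> t i j; rewrite -Re_toC_mul; under eq_fun do rewrite mxE.
  by have [] := UA t i j.
- move=> t i j; rewrite -Im_toC_mul; under eq_fun do rewrite mxE.
  by have [] := UA t i j.
- move=> i j; under eq_fun do rewrite !mxE.
  rewrite (_ : (fun _ => _) = (fun t => U t i j)) //.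
  by apply/funext => t; case: (U t i j).
Qed.

Definition exp_bound calA (eps C : R) := 0 <= C /\ forall Af x,
  switching calA Af -> trajectory Af x ->
  forall t, 0 <= t -> `|x t| <= C * expR (- eps * t) * `|x 0|.

Lemma lyap_exp_bound calA eps : (lyap calA < (- eps)%:E)%E ->
  exists C, exp_bound calA eps C.
Proof.
move=> /ereal_inf_lt[_ [a [C hC] <-]]; rewrite lte_fin => a_eps.
exists `|C|; split=> // Af x sw tr t t0.
rewrite (le_trans (hC Af x sw tr t t0)) // ler_wpM2r //.
rewrite (@le_trans _ _ (`|C| * expR (a * t))) //.
  by rewrite ler_wpM2r ?expR_ge0 // ler_norm.
by rewrite ler_wpM2l // ler_expR ler_wpM2r // ltW.
Qed.

Variables (calA : set 'M[R]_n) (eps C : R).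
Hypothesis bounded_traj : exp_bound calA eps C.

(* The exponential bound itself yields uniqueness; applied to the imaginary part
   of the complex solution, it shows that this solution is real. *)
Lemma zero_solution A Y t : calA A -> matrix_ode A Y -> Y 0 = 0 ->
  0 <= t -> Y t = 0.
Proof.
move=> cA YA Y0 t0; apply/matrixP => i j; rewrite mxE.
have tr := linear_ode_trajectory (matrix_ode_linear (delta_mx j (ord0 : 'I_1)) YA).
have := bounded_traj.2 _ _ (switching_cst cA) tr t t0.
rewrite Y0 mul0mx normr0 mulr0 => Yt.
have := entry_le_norm (Y t *m delta_mx j (ord0 : 'I_1)) i ord0.
move=> /le_trans /(_ Yt); rewrite normr_le0 -colE mxE => /eqP //.
Qed.

(* The factor added last acts first on a vector, so that evaluating the functional
   amounts to prolonging a trajectory at its end. *)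
Inductive flow_functional : 'rV[R]_n -> Prop :=
| flow_coord i : flow_functional (delta_mx ord0 i)
| flow_step l A E t : calA A -> matrix_ode A E -> E 0 = 1%:M -> 0 <= t ->
    flow_functional l -> flow_functional (expR (eps * t) *: (l *m E t)).

(** Applying [l *m E t] at time [T] amounts to applying [l] at time [T + t] to the trajectory
    continued by the flow of [A]. The factor [expR (eps * t)] exactly cancels the extra decay over
    the duration [t], so [C] does not grow with the number of factors. *)
Lemma flow_functional_trajectory l Af x T : flow_functional l ->
  switching calA Af -> trajectory Af x -> 0 <= T ->
  `|(l *m x T) ord0 ord0| <= C * expR (- eps * T) * `|x 0|.
Proof.
move=> fl; elim: fl Af x T => [i|{}l A E t cA EA E0 t0 _ IH] Af x T sw tr T0.
  have [_ bound] := bounded_traj.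
  by rewrite -rowE mxE (le_trans (entry_le_norm _ _ _)) // (bound Af).
pose y s := E s *m x T.
have y0 : y 0 = x T by rewrite /y E0 mul1mx.
have yA : linear_ode A y := matrix_ode_linear (x T) EA.
have := IH _ _ (T + t) (switching_append T sw cA)
  (trajectory_append T0 tr yA y0) (addr_ge0 T0 t0).
rewrite T0.
(* For [t = 0] the test selects the first branch, which agrees with [y 0]. *)
have -> : (if T + t <= T then x (T + t) else y (T + t - T)) = y t.
  rewrite addrC addrK; case: ifPn => //; rewrite gerDr => t_le0.
  by have -> : t = 0; [apply/le_anti; rewrite t_le0 t0|rewrite add0r y0].
move=> le_t; rewrite -scalemxAl mxE normrM (ger0_norm (expR_ge0 _)).
rewrite -mulmxA -/(y t) (le_trans (ler_wpM2l (expR_ge0 _) le_t)) //.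
rewrite mulrDr expRD !mulrA (_ : expR (eps * t) * C * expR (- eps * T) *
  expR (- eps * t) = expR (eps * t) * expR (- eps * t) * (C * expR (- eps * T)));
  last by ring.
by rewrite -expRD mulNr subrr expR0 mul1r.
Qed.

(** This is the trajectory estimate at time 0; [A] only supplies a trajectory issuing from [x]. It
    makes the extremal norm finite. *)
Lemma flow_functional_bound A l (x : 'cV[R]_n) : calA A -> flow_functional l ->
  `|(l *m x) ord0 ord0| <= C * `|x|.
Proof.
move=> cA fl; have [E [_ [E0 _ EA _ _]]] := real_matrix_solution A.
have := flow_functional_trajectory fl (switching_cst cA)
  (linear_ode_trajectory (matrix_ode_linear x EA)) (lexx 0).
by rewrite E0 mul1mx mulr0 expR0 mulr1.
Qed.

(** Membership of [x] in the ball of radius [m] of the extremal norm; the supremum defining that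
    norm is never formed. *)
Definition flow_bounded (x : 'cV[R]_n) (m : R) :=
  forall l, flow_functional l -> `|(l *m x) ord0 ord0| <= m.

Lemma norm_flow_bounded (x : 'cV[R]_n) (m : R) : 0 <= m -> flow_bounded x m -> `|x| <= m.
Proof.
move=> m0 xm; apply: norm_le_entries => // i j.
by have := xm _ (flow_coord i); rewrite -rowE mxE (ord1 j).
Qed.

(** The family of functionals is stable under composition with the rescaled flows, so these flows
    contract the extremal norm. *)
Lemma flow_bounded_step A E t x m : calA A -> matrix_ode A E -> E 0 = 1%:M ->
  0 <= t -> flow_bounded x m -> flow_bounded (expR (eps * t) *: (E t *m x)) m.
Proof.
move=> cA EA E0 t0 xm l fl.
have := xm _ (flow_step cA EA E0 t0 fl).
by rewrite -scalemxAl -scalemxAr mulmxA.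
Qed.

Lemma shifted_ode A E x : matrix_ode A E ->
  linear_ode (A + eps%:M) (fun t => expR (eps * t) *: (E t *m x)).
Proof.
move=> EA t i; under eq_fun do rewrite mxE.
have D := is_derive_mul (is_derive_expRM eps t) (matrix_ode_linear x EA t i).
apply: (is_derive_eq D).
rewrite mulmxDl mul_scalar_mx -scalemxAr !mxE; ring.
Qed.

Lemma euler_step A E (K m : R) x (tau : R) : calA A -> matrix_ode A E -> E 0 = 1%:M ->
  tau * eps < 1 -> 0 < tau -> flow_bounded x m ->
  (forall l t, flow_functional l -> 0 <= t ->
    `|(l *m ((A + eps%:M) *m ((A + eps%:M) *m
        (expR (eps * t) *: (E t *m x))))) ord0 ord0| <= K * m) ->
  flow_bounded ((1%:M + tau *: A) *m x)
    ((1 - tau * eps + tau ^+ 2 * K / (2 * (1 - tau * eps))) * m).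
Proof.
move=> cA EA E0 te tau0 xm hK l fl.
set B := A + eps%:M in hK *.
pose y t := expR (eps * t) *: (E t *m x).
have yB : linear_ode B y := shifted_ode x EA.
pose g t := (l *m y t) ord0 ord0.
pose g1 t := (l *m (B *m y t)) ord0 ord0.
pose g2 t := (l *m (B *m (B *m y t))) ord0 ord0.
have gd (t : R) : is_derive t 1 g (g1 t) := linear_ode_mul l t ord0 yB.
have g1d (t : R) : is_derive t 1 g1 (g2 t).
  have -> : g1 = fun s => (l *m B *m y s) ord0 ord0.
    by apply/funext => s; rewrite /g1 mulmxA.
  by rewrite /g2 mulmxA; exact: linear_ode_mul.
have y0 : y 0 = x by rewrite /y mulr0 expR0 scale1r E0 mul1mx.
have d0 : 0 < 1 - tau * eps by rewrite subr_gt0.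
(* This [s] satisfies $1 + \tau A = (1 - \tau\varepsilon)(1 + s(A + \varepsilon))$, which turns the
   Euler step for [A] into a scaled Euler step for [A + eps%:M]. *)
pose s := tau / (1 - tau * eps).
have s0 : 0 <= s by rewrite divr_ge0 ?ltW.
have gs : `|g s| <= m := flow_bounded_step cA EA E0 s0 xm fl.
have up : g 0 + s * g1 0 <= m + K * m * s ^+ 2 / 2.
  have := taylor2_upper (K := K * m) s0 gd g1d.
  move=> /(_ _)/le_trans; apply.
    by move=> t t0; have := hK l t fl t0; rewrite ler_norml => /andP[].
  by rewrite lerD2r (le_trans (ler_norm _)).
(* The same estimate for [- g] supplies the other half of the absolute value. *)
have dn : - g 0 + s * - g1 0 <= m + K * m * s ^+ 2 / 2.
  have := @taylor2_upper _ (fun t => - g t) (fun t => - g1 t) (fun t => - g2 t)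
    (K * m) s s0.
  move=> /(_ _ _ _)/le_trans; apply.
    by move=> t t0; have := hK l t fl t0; rewrite ler_norml lerN2 => /andP[].
  by rewrite lerD2r (le_trans _ gs) // -normrN ler_norm.
have -> : (l *m ((1%:M + tau *: A) *m x)) ord0 ord0
    = (1 - tau * eps) * (g 0 + s * g1 0).
  have -> : g1 0 = (l *m (A *m x)) ord0 ord0 + eps * g 0.
    rewrite /g1 /g y0 /B mulmxDl mul_scalar_mx mulmxDr -scalemxAr.
    by rewrite [LHS]mxE [X in _ + X]mxE.
  rewrite /g y0 mulmxDl mul1mx mulmxDr -scalemxAl -scalemxAr.
  rewrite [LHS]mxE [X in _ + X]mxE /s.
  by field; rewrite gt_eqF.
rewrite normrM (ger0_norm (ltW d0)).
have -> : (1 - tau * eps + tau ^+ 2 * K / (2 * (1 - tau * eps))) * m =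
    (1 - tau * eps) * (m + K * m * s ^+ 2 / 2).
  by rewrite /s; field; rewrite gt_eqF.
rewrite ler_wpM2l ?(ltW d0) // ler_norml up andbT lerNl.
by rewrite opprD -mulrN.
Qed.

End FundamentalSolutions.

(** * Joint spectral radius *)

Section JointSpectralRadius.
Variables (R : realType) (n : nat).

(** The [k]-th root of [c * q ^+ k] tends to [q], whatever the constant [c]. *)
Lemma jsr_lt1 (B : set 'M[R]_n) (c q : R) : 0 < c -> 0 < q -> q < 1 ->
  (forall k (f : 'I_k -> 'M[R]_n), (forall i, B (f i)) ->
    `|\prod_(i < k) f i| <= c * q ^+ k) ->
  jsr B < 1.
Proof.
move=> c0 q0 q1 hB; rewrite /jsr; set u := (X in limn X).
(* A divergent sequence would have the default limit 0; no convergence (Fekete)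
   argument is needed. *)
have [cu|ncu] := pselect (cvgn u); last by rewrite dvgP.
(* Index 0 is excluded: there the exponent [k%:R^-1] is 0, so [u 0] is 1 while the bound would be
   [q]. *)
have u_le k : (0 < k)%N -> u k <= expR (k%:R^-1 * ln c) * q.
  move=> k0; rewrite /u; set S := [set _ | f in _].
  have Sub : ubound S (c * q ^+ k) by move=> _ [f hf <-]; exact: hB.
  have cq0 : 0 <= c * q ^+ k by rewrite mulr_ge0 ?exprn_ge0 // ltW.
  have [s0 s1] : 0 <= sup S /\ sup S <= c * q ^+ k.
    (* If there are no products at all, [sup] takes its default value 0. *)
    have [->|/set0P[_ [f hf _]]] := eqVneq S set0; first by rewrite sup0.
    have Sf : S `|\prod_(i < k) f i| by exists f.
    split; last by apply: ge_sup => //; exists `|\prod_(i < k) f i|.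
    rewrite (le_trans (normr_ge0 (\prod_(i < k) f i))) // ub_le_sup //.
    by exists (c * q ^+ k).
  rewrite (le_trans (ge0_ler_powR _ _ _ s1)) ?nnegrE ?invr_ge0 //.
  rewrite powRM ?exprn_ge0 ?(ltW c0) ?(ltW q0) //.
  rewrite -(powR_mulrn _ (ltW q0)) -powRrM mulfV ?pnatr_eq0 -?lt0n //.
  by rewrite powRr1 ?(ltW q0) // /powR gt_eqF.
have inv_k : k%:R^-1 @[k --> \oo] --> (0 : R).
  apply/gtr0_cvgV0; last exact: cvgr_idn.
  by near=> k; rewrite ltr0n; near: k; exact: nbhs_infty_gt.
have v_q : expR (k%:R^-1 * ln c) * q @[k --> \oo] --> expR (0 * ln c) * q.
  apply: cvgMl; apply: continuous_cvg; first exact: continuous_expR.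
  exact: cvgMl.
rewrite mul0r expR0 mul1r in v_q.
apply: le_lt_trans q1; rewrite -(cvg_lim _ v_q) //.
apply: ler_lim => //; first by apply/cvg_ex; exists q.
by near=> k; apply: u_le; near: k; exact: nbhs_infty_gt.
Unshelve. all: by end_near.
Qed.

End JointSpectralRadius.

(** * Curvature bounds and contraction of Euler products *)

Section EulerBound.
Variables (R : realType) (n : nat) (calA : set 'M[R]_n) (eps C : R).
Hypothesis bounded_traj : exp_bound calA eps C.
Implicit Types (A : 'M[R]_n) (E Y : R -> 'M[R]_n) (l : 'rV[R]_n) (x : 'cV[R]_n).

(** The quantity bounded is the second derivative in [t] of [l] applied to the rescaled flow from
    [x], measured against the extremal norm of [x]. Two values of [K] are supplied below, one from
    matrix norms and one from [M2]. *)
Definition curvature_bound A E (K : R) := forall x (m : R) l t, 0 < m ->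
  flow_bounded calA eps x m -> flow_functional calA eps l -> 0 <= t ->
  `|(l *m ((A + eps%:M) *m ((A + eps%:M) *m
        (expR (eps * t) *: (E t *m x))))) ord0 ord0| <= K * m.

Lemma jsr_euler (K tau : R) A0 : calA A0 -> 0 < eps -> 0 <= K -> 0 < tau ->
  tau * (K + 2 * eps ^+ 2) < 2 * eps ->
  (forall A, calA A -> exists E, [/\ matrix_ode A E, E 0 = 1%:M &
    curvature_bound A E K]) ->
  jsr [set 1%:M + tau *: A | A in calA] < 1.
Proof.
move=> cA0 eps0 K0 tau0 tauK hA.
have te : tau * eps < 1.
  have K2 : 0 <= tau * K by rewrite mulr_ge0 // ltW.
  by rewrite -(ltr_pM2r eps0); nra.
have d0 : 0 < 1 - tau * eps by rewrite subr_gt0.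
pose q := 1 - tau * eps + tau ^+ 2 * K / (2 * (1 - tau * eps)).
have q0 : 0 < q.
  by rewrite ltr_wpDr // divr_ge0 ?mulr_ge0 ?sqr_ge0 // ltW.
have q1 : q < 1.
  (* Once the denominator is cleared, this is the assumption on [tau] multiplied by [tau]. *)
  suff : tau ^+ 2 * K / (2 * (1 - tau * eps)) < tau * eps by rewrite /q; lra.
  rewrite ltr_pdivrMr ?mulr_gt0 //.
  have : tau * (tau * (K + 2 * eps ^+ 2)) < tau * (2 * eps) by rewrite ltr_pM2l.
  by rewrite -subr_gt0 => ?; rewrite -subr_gt0; nra.
have C0 : 0 <= C by have [] := bounded_traj.
apply: (@jsr_lt1 _ _ _ (C + 1) q) => //; first by rewrite ltr_wpDl.
(* The rightmost factor acts first: it replaces [x] by its image and [m] by [q * m] before the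
   induction hypothesis is used, so both must be quantified inside. *)
have prod_le k : forall (f : 'I_k -> 'M[R]_n) x (m : R),
    (forall i, [set 1%:M + tau *: A | A in calA] (f i)) -> 0 < m ->
    flow_bounded calA eps x m ->
    flow_bounded calA eps ((\prod_(i < k) f i) *m x) (m * q ^+ k).
  elim: k => [|k IH] f x m hf m0 xm; first by rewrite big_ord0 mul1mx mulr1.
  rewrite big_ord_recr /= -mulmxE -mulmxA exprS mulrA.
  apply: IH => [i||]; [exact: hf|by rewrite mulr_gt0|].
  have [A cA <-] := hf ord_max; have [E [EA E0 EK]] := hA A cA.
  rewrite mulrC; apply: (euler_step cA EA E0 te tau0 xm) => l t fl t0.
  exact: EK.
move=> k f hf; apply: norm_le_entries => [|i j].
  by apply: mulr_ge0; [exact: addr_ge0|apply: exprn_ge0; exact: ltW].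
(* The radius is [C + 1] rather than [C] because [curvature_bound] needs a positive radius. *)
have e_j : flow_bounded calA eps (delta_mx j ord0) (C + 1).
  move=> l fl; rewrite (le_trans (flow_functional_bound bounded_traj _ cA0 fl)) //.
  rewrite (@le_trans _ _ C) ?lerDl // ler_piMr //.
  by apply: norm_le_entries => // i' j'; rewrite mxE normr_nat lern1 leq_b1.
have C1 : 0 < C + 1 by rewrite ltr_wpDl.
have := prod_le k f _ _ hf C1 e_j _ (flow_coord _ _ i).
by rewrite -rowE mxE -colE mxE.
Qed.

(** Each factor [A + eps%:M] costs [n%:R * (b + eps)] in the maximum norm, and the functional costs
    [C]. The bound is crude, but it depends on [A] only through [b]. *)
Lemma norm_curvature_bound A E b : calA A -> 0 < eps -> matrix_ode A E ->
  E 0 = 1%:M -> `|A| <= b ->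
  curvature_bound A E (C * (n%:R * (b + eps)) ^+ 2).
Proof.
move=> cA eps0 EA E0 Ab x m l t m0 xm fl t0.
have C0 : 0 <= C by have [] := bounded_traj.
set y := expR (eps * t) *: _; set B := A + eps%:M.
have ym : `|y| <= m.
  apply: (norm_flow_bounded (ltW m0)); exact: (flow_bounded_step cA EA E0 t0 xm).
have Bb : `|B| <= b + eps.
  rewrite (le_trans (ler_normD _ _)) // lerD //.
  apply: norm_le_entries => [|i j]; first exact: ltW.
  rewrite mxE; case: eqP => _; last by rewrite normr0 ltW.
  by rewrite mulr1n gtr0_norm.
have step (z : 'cV[R]_n) : `|B *m z| <= n%:R * (b + eps) * `|z|.
  rewrite (le_trans (norm_mulmx_le _ _)) // ler_wpM2r // ler_wpM2l //.
have nb : 0 <= n%:R * (b + eps).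
  by rewrite mulr_ge0 // (le_trans _ Bb).
rewrite (le_trans (flow_functional_bound bounded_traj _ cA fl)) //.
set c := n%:R * (b + eps) in step nb *.
have -> : C * c ^+ 2 * m = C * (c * (c * m)) by ring.
rewrite ler_wpM2l // (le_trans (step _)) // ler_wpM2l //.
by rewrite (le_trans (step _)) // ler_wpM2l.
Qed.

Lemma cexp_real (a t : R) : cexp (Complex a 0) t = Complex (expR (a * t)) 0.
Proof. by rewrite /cexp /= mul0r cos0 sin0 mulr1 mulr0. Qed.

Lemma cmod_ge_Re (z : R[i]) : `|complex.Re z| <= cmod z.
Proof. by rewrite -sqrtr_sqr ler_wsqrtr // lerDl sqr_ge0. Qed.

Lemma cmod_real (a : R) : cmod (Complex a 0) = `|a|.
Proof. by rewrite /cmod /= expr0n /= addr0 sqrtr_sqr. Qed.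

(** Divided by [m], the scalar function [l] of the rescaled flow is a competitor in the definition
    of [M2]: it is an exponential polynomial, and contraction bounds it by 1 on the half-line. *)
Lemma M2_curvature_bound A E Y K : calA A -> matrix_ode A E ->
  E 0 = 1%:M -> matrix_ode A Y -> Y 0 = 0 ->
  (forall i j, exp_poly (char_poly (toC A))
     (fun t => Complex (E t i j) (Y t i j))) ->
  (M2 A eps <= K%:E)%E -> curvature_bound A E K.
Proof.
move=> cA EA E0 YA Y0 hexp M2K x m l t m0 xm fl t0.
pose F s := \sum_(i < n) \sum_(j < n)
  Complex (m^-1 * (l ord0 i * x j ord0)) 0 * Complex (E s i j) (Y s i j).
have bilin (Z : 'M[R]_n) : \sum_(i < n) \sum_(j < n)
    m^-1 * (l ord0 i * x j ord0) * Z i j = m^-1 * (l *m (Z *m x)) ord0 ord0.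
  rewrite mxE mulr_sumr; apply: eq_bigr => i _.
  rewrite mxE !mulr_sumr; apply: eq_bigr => j _; ring.
have ReF s : complex.Re (F s) = m^-1 * (l *m (E s *m x)) ord0 ord0.
  rewrite -bilin (big_morph (@complex.Re R) (@Re_add R) (erefl : complex.Re 0 = 0)).
  apply: eq_bigr => i _.
  rewrite (big_morph (@complex.Re R) (@Re_add R) (erefl : complex.Re 0 = 0)).
  by apply: eq_bigr => j _; rewrite Re_mul /= mul0r subr0.
have ImF s : complex.Im (F s) = m^-1 * (l *m (Y s *m x)) ord0 ord0.
  rewrite -bilin (big_morph (@complex.Im R) (@Im_add R) (erefl : complex.Im 0 = 0)).
  apply: eq_bigr => i _.
  rewrite (big_morph (@complex.Im R) (@Im_add R) (erefl : complex.Im 0 = 0)).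
  by apply: eq_bigr => j _; rewrite Im_mul /= mul0r addr0.
pose p s := cexp (Complex eps 0) s * F s.
have p_in : inP A eps p.
  apply: inP_exp_poly; apply: exp_poly_sum => i _; apply: exp_poly_sum => j _.
  exact: exp_polyMl.
pose y s := expR (eps * s) *: (E s *m x).
have Rep s : complex.Re (p s) = m^-1 * (l *m y s) ord0 ord0.
  rewrite /p cexp_real Re_mul /= mul0r subr0 ReF /y -scalemxAr [in RHS]mxE; ring.
have p_real s : 0 <= s -> p s = Complex (m^-1 * (l *m y s) ord0 ord0) 0.
  move=> s0; rewrite -Rep; have : complex.Im (p s) = 0.
    rewrite /p cexp_real Im_mul /= mul0r addr0 ImF.
    by rewrite (zero_solution bounded_traj cA YA Y0 s0) mul0mx mulmx0 mxE !mulr0.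
  by case: (p s) => a b /= ->.
have p_le1 : (supnorm p <= 1)%E.
  apply: ge_ereal_sup => _ [s s0 <-]; rewrite p_real // cmod_real lee_fin.
  rewrite normrM gtr0_norm ?invr_gt0 // mulrC ler_pdivrMr // mul1r.
  exact: (flow_bounded_step cA EA E0 s0 xm fl).
have yB : linear_ode (A + eps%:M) y := shifted_ode eps x EA.
(* The real part suffices, being dominated by the modulus. The imaginary part is known to vanish
   only for nonnegative times, whereas the derivatives at 0 look at both sides. *)
have d2p : complex.Re (d2 p t) = m^-1 *
    (l *m ((A + eps%:M) *m ((A + eps%:M) *m y t))) ord0 ord0.
  have D1 (s : R) : is_derive s 1 (fun s => complex.Re (p s))
      (m^-1 * (l *m ((A + eps%:M) *m y s)) ord0 ord0).
    under eq_fun do rewrite Rep.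
    have D := is_derive_mul (is_derive_cst m^-1 s (1 : R))
      (linear_ode_mul l s ord0 yB).
    by apply: (is_derive_eq D); rewrite mul0r add0r.
  have D2 (s : R) : is_derive s 1
      (fun s => m^-1 * (l *m ((A + eps%:M) *m y s)) ord0 ord0)
      (m^-1 * (l *m ((A + eps%:M) *m ((A + eps%:M) *m y s))) ord0 ord0).
    under eq_fun do rewrite mulmxA.
    have D := is_derive_mul (is_derive_cst m^-1 s (1 : R))
      (linear_ode_mul (l *m (A + eps%:M)) s ord0 yB).
    by apply: (is_derive_eq D); rewrite mul0r add0r -mulmxA.
  by rewrite /d2 /= (is_derive_derive1 D1) (is_derive_derive1 D2).
have : ((cmod (d2 p t))%:E <= K%:E)%E.
  apply: le_trans M2K; apply: (@le_trans _ _ (supnorm (d2 p))).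
    by apply: ereal_sup_ubound; exists t.
  by apply: ereal_sup_ubound; exists p.
rewrite lee_fin => /(le_trans (cmod_ge_Re _)).
by rewrite d2p normrM gtr0_norm ?invr_gt0 // mulrC ler_pdivrMr.
Qed.

End EulerBound.

(** The zero function is a competitor. This excludes the value [-oo] in the case analysis on
    [M2]. *)
Lemma M2_ge0 (R : realType) n (A : 'M[R]_n) eps : (0 <= M2 A eps)%E.
Proof.
apply: (@le_trans _ _ (supnorm (d2 (fun=> 0 : R[i])))).
  apply: (@le_trans _ _ (cmod (d2 (fun=> 0 : R[i]) 0))%:E).
    by rewrite lee_fin sqrtr_ge0.
  by apply: ereal_sup_ubound; exists 0 => //=.
apply: ereal_sup_ubound; exists (fun=> 0) => //; split.
  by exists [::]; split=> // t; rewrite big_nil.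
by apply: ge_ereal_sup => _ [t _ <-]; rewrite cmod_real normr0 lee_fin.
Qed.

(** * Lower bound for the critical step size *)

Unset Implicit Arguments.

Theorem theorem4 (R : realType) (n : nat) (eps r : R) (calA : set 'M[R]_n) :
  0 < eps -> eps < r -> compact calA -> calA !=set0 ->
  (forall A, calA A -> specrad A <= r) ->
  (ereal_inf [set ((2 * eps)%:E / (M2 A eps + (2 * eps ^+ 2)%:E))%E | A in calA]
     <= Sfun calA eps)%E.
Proof.
move=> eps0 _ calA_cpt [A0 cA0] _; rewrite /Sfun.
case: ifPn => [_|]; first exact: leey.
rewrite -ltNge => /lyap_exp_bound[C hC].
have C0 : 0 <= C by have [] := hC.
set T := ereal_inf _; set S := ereal_sup _.
have S_ge tau : 0 < tau -> jsr [set 1%:M + tau *: A | A in calA] < 1 ->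
    (tau%:E <= S)%E.
  by move=> tau0 jtau; apply: ereal_sup_ubound; exists tau.
have e2 : 0 < 2 * eps ^+ 2 by rewrite mulr_gt0 // exprn_gt0.
have [T_le0|T_gt0] := leP T 0%E.
  (* It suffices that some step is admissible: the supremum of the empty set is
     [-oo].  Compactness bounds the second derivatives crudely but uniformly. *)
  have [b calAb] : exists b, forall A, calA A -> `|A| <= b.
    have [b [_ hb]] := compact_bounded calA_cpt.
    by exists (b + 1) => A cA; apply: hb => //; rewrite ltrDl.
  pose K := C * (n%:R * (b + eps)) ^+ 2.
  have K0 : 0 <= K by rewrite mulr_ge0 ?sqr_ge0.
  have d0 : 0 < K + 2 * eps ^+ 2 by rewrite ltr_wpDl.
  (* Half of the threshold [2 * eps / (K + 2 * eps ^+ 2)], to obtain a strict inequality. *)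
  pose tau := eps / (K + 2 * eps ^+ 2).
  have tau0 : 0 < tau by rewrite divr_gt0.
  apply: (@le_trans _ _ tau%:E).
    by rewrite (le_trans T_le0) // lee_fin ltW.
  apply: S_ge => //; apply: (jsr_euler hC cA0 eps0 K0 tau0).
    by rewrite /tau divfK ?gt_eqF // ltr_pMl // ltr1n.
  move=> A cA; have [E [_ [E0 _ EA _ _]]] := real_matrix_solution A.
  by exists E; split=> //; apply: norm_curvature_bound => //; exact: calAb.
(* A positive infimum forces every [M2 A eps] to be finite, as the quotient is 0 when [M2 A eps] is
   [+oo]. *)
have T_le A : calA A -> exists2 a, M2 A eps = a%:E /\ 0 <= a &
    (T <= (2 * eps / (a + 2 * eps ^+ 2))%:E)%E.
  move=> cA; have : (T <= (2 * eps)%:E / (M2 A eps + (2 * eps ^+ 2)%:E))%E.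
    by apply: ereal_inf_lbound; exists A.
  have := M2_ge0 A eps; case: (M2 A eps) => [a| |] //.
    rewrite lee_fin => a0; have d0 : 0 < a + 2 * eps ^+ 2 by rewrite ltr_wpDl.
    by rewrite -EFinD inver gt_eqF // -EFinM => Ta; exists a.
  by rewrite addye // invey mule0 => _ /(lt_le_trans T_gt0); rewrite ltxx.
have [T0 TE] : exists T0, T = T0%:E.
  have [a _ Ta] := T_le A0 cA0; exists (fine T); rewrite fineK //.
  by rewrite gt0_fin_numE // (le_lt_trans Ta) // ltry.
rewrite TE lte_fin in T_gt0; rewrite TE.
(* The solution of [2 * eps / (K + 2 * eps ^+ 2) = T0]; it bounds [M2 A eps] for the whole family at
   once. *)
pose K := 2 * eps / T0 - 2 * eps ^+ 2.
have M2K A : calA A -> (M2 A eps <= K%:E)%E /\ 0 <= K.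
  move=> cA; have [a [-> a0]] := T_le A cA.
  have d0 : 0 < a + 2 * eps ^+ 2 by rewrite ltr_wpDl.
  rewrite TE lee_fin ler_pdivlMr // mulrC -ler_pdivlMr // -lerBrDr => aK.
  by rewrite lee_fin; split=> //; exact: le_trans aK.
have [_ K0] := M2K A0 cA0.
have S_ge_lt tau : 0 < tau -> tau < T0 -> (tau%:E <= S)%E.
  move=> tau0 tauT; apply: S_ge => //; apply: (jsr_euler hC cA0 eps0 K0 tau0).
    by rewrite /K subrK mulrA ltr_pdivrMr // mulrC ltr_pM2l // mulr_gt0.
  move=> A cA; have [E [Y [E0 Y0 EA YA hexp]]] := real_matrix_solution A.
  exists E; split=> //.
  by apply: (M2_curvature_bound hC cA EA E0 YA Y0 hexp); have [] := M2K A cA.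
(* All steps in []0, T0[] are admissible. If [S] were below [T0], the step [T0 / 2] would make it a
   positive real [s], and the midpoint of [s] and [T0] would be an admissible step exceeding it. *)
rewrite leNgt; apply/negP => ST.
have S0 := S_ge_lt (T0 / 2) ltac:(lra) ltac:(lra).
move: S_ge_lt ST S0; case: (S) => [s| |] // S_ge_lt.
rewrite lte_fin lee_fin => sT s0.
by have := S_ge_lt ((s + T0) / 2) ltac:(lra) ltac:(lra); rewrite lee_fin; lra.
Qed.
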